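(* Let $\mathcal T_n$ be the set of Cayley trees labelled with $[n]_0$ and $\mathcal{PF}_n$ the set of parking functions of length $n$. The map $\rho_n:\mathcal{PF}_n\to\mathcal T_n$, $\pi\mapsto \mathrm{PT}(\pi)$, is a bijection that is record-preserving, i.e. $\mathrm{Rec}(\pi)=\mathrm{Rec}(\mathrm{PT}(\pi))$ for every $\pi\in\mathcal{PF}_n$. Its inverse is $T\mapsto \pi_T$.
   Context: A Cayley tree labelled with $[n]_0=\{0,\dots,n\}$ is a tree on vertex set $[n]_0$ rooted at $0$, with parent map $f_T:[n]\to[n]_0$. A non-root vertex $k$ is a record if it is the largest label on the path from $k$ to the root; $\mathrm{Rec}(T)$ is the set of records. Weary permutation $\omega_T$: run priority-first search from $0$ (at each step visit the smallest unvisited vertex adjacent to a visited vertex); $\omega_T(i)$ is the $i$-th non-root vertex visited, $\omega_T(0)=0$. The preference sequence of $T$ is $\pi_T=(\pi_T(1),\dots,\pi_T(n))$ with $\pi_T(i)=\omega_T^{-1}(f_T(i))+1$. A parking function of length $n$ is a sequence $\pi=(a_1,\dots,a_n)$ in $[n]$ such that when cars $1,\dots,n$ enter in order a street with spots $1,\dots,n$, car $i$ parking in the first free spot $j\ge a_i$, all cars park; $\omega_\pi(j)$ is the car in spot $j$, and $\omega_\pi(0)=0$. $\mathrm{Rec}(\pi)$ is the set of left-to-right maxima of the word $\omega_\pi(1)\cdots\omega_\pi(n)$. The parking tree $\mathrm{PT}(\pi)$ is the Cayley tree labelled with $[n]_0$, rooted at $0$, with parent map $f_\pi(i)=\omega_\pi(\pi(i)-1)$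 for $i\in[n]$. *)

(* Defs.v *)
From mathcomp Require Import all_boot.

Set Implicit Arguments.
Unset Strict Implicit.
Unset Printing Implicit Defensive.

(* The vertex set [n]_0 = {0, ..., n} is 'I_n.+1.  The index i : 'I_n stands
   for the element i + 1 of [n] = {1, ..., n}; its label is label i. *)
Definition label n (i : 'I_n) : 'I_n.+1 := lift ord0 i.

(* ---- Cayley trees ---- *)

(* A graph on [n]_0 is given by its set of edges. *)
Definition graph n := {set {set 'I_n.+1}}.

Definition adj n (E : graph n) : rel 'I_n.+1 := fun x y => [set x; y] \in E.

(* A duplicate-free sequence of vertices has length at most n + 1, so bounding
   the length of c below loses no cycle; bounded sequences form a finType. *)
Definition is_tree n (E : graph n) : bool :=
  [&& [forall e in E, #|e| == 2],
      [forall x, forall y, connect (adj E) x y]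
    & [forall c : {bseq n.+1 of 'I_n.+1},
         (2 < size c) ==> ~~ ucycleb (adj E) c]].

Definition cayley_tree n := {E : graph n | is_tree E}.

(* The vertices, k excluded, of the simple path from k to the root 0 (unique
   when E is a tree; the junk value [::] is returned if there is none). *)
Definition root_path n (E : graph n) (k : 'I_n.+1) : seq 'I_n.+1 :=
  if [pick p : {bseq n of 'I_n.+1} |
       [&& path (adj E) k p, last k p == ord0 & uniq (k :: p)]] is Some p
  then p else [::].

Definition parent n (E : graph n) (i : 'I_n) : 'I_n.+1 :=
  head ord0 (root_path E (label i)).

Definition tree_records n (E : graph n) : {set 'I_n.+1} :=
  [set k : 'I_n.+1 | (k != ord0) && all (fun v : 'I_n.+1 => v <= k) (root_path E k)].

(* One step of priority-first search, s being the sequence of visited vertices.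
   enum 'I_n.+1 is increasing, so ohead selects the smallest candidate. *)
Definition search_step n (E : graph n) (s : seq 'I_n.+1) : seq 'I_n.+1 :=
  if ohead [seq v <- enum 'I_n.+1 | (v \notin s) && has (fun u => adj E u v) s]
    is Some v then rcons s v else s.

(* The word omega_T(0) omega_T(1) ... omega_T(n), with omega_T(0) = 0. *)
Definition tree_weary n (E : graph n) : seq 'I_n.+1 :=
  iter n (search_step E) [:: ord0].

Definition tree_omega n (E : graph n) (i : nat) : 'I_n.+1 :=
  nth ord0 (tree_weary E) i.

Definition tree_omega_inv n (E : graph n) (v : 'I_n.+1) : nat :=
  index v (tree_weary E).

Definition pref_seq n (E : graph n) : n.-tuple nat :=
  [tuple (tree_omega_inv E (parent E i)).+1 | i < n].

(* ---- Parking functions ---- *)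

(* street j = Some i when car i + 1 occupies spot j + 1. *)
Definition street n := {ffun 'I_n -> option 'I_n}.

(* Car i + 1, of preference a = tnth pi i (spots are numbered from 1), takes
   the first free spot j + 1 >= a, and leaves unparked if there is none. *)
Definition park_car n (pi : n.-tuple nat) (s : street n) (i : 'I_n) : street n :=
  if ohead [seq j : 'I_n <- enum 'I_n | (tnth pi i <= j.+1) && (s j == None)]
    is Some j then [ffun k => if k == j then Some i else s k] else s.

Definition parked n (pi : n.-tuple nat) : street n :=
  foldl (park_car pi) [ffun=> None] (enum 'I_n).

Definition is_parking n (pi : n.-tuple nat) : bool :=
  all (fun a => 1 <= a <= n) pi
  && [forall i : 'I_n, exists j : 'I_n, parked pi j == Some i].

Definition parking_function n := {a : n.-tuple nat | is_parking a}.

(* omega_pi(0) = 0 and omega_pi(j) is the car in spot j; the default ord0 for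
   an empty spot is never used when pi is a parking function. *)
Definition park_weary n (pi : n.-tuple nat) : seq 'I_n.+1 :=
  ord0 :: [seq oapp (@label n) ord0 (parked pi j) | j <- enum 'I_n].

Definition park_omega n (pi : n.-tuple nat) (j : nat) : 'I_n.+1 :=
  nth ord0 (park_weary pi) j.

(* Left-to-right maxima of omega_pi(1) ... omega_pi(n). *)
Definition park_records n (pi : n.-tuple nat) : {set 'I_n.+1} :=
  [set park_omega pi j.+1 | j : 'I_n
     & [forall k : 'I_n, (k < j) ==> (park_omega pi k.+1 < park_omega pi j.+1)]].

Definition park_parent n (pi : n.-tuple nat) (i : 'I_n) : 'I_n.+1 :=
  park_omega pi (tnth pi i - 1).

Definition parking_tree n (pi : n.-tuple nat) : graph n :=
  [set [set label i; park_parent pi i] | i : 'I_n].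

(* Main.v *)
(* Call a word w on all the vertices, starting with 0, greedy for a parent map
   f when every vertex is listed after its parent and each vertex listed is the
   smallest among the unlisted ones whose parent is already listed. There is
   exactly one greedy word for a given acyclic f. The priority-first search of a
   tree is greedy for its parent map. For a parking function pi, the word
   omega_pi is greedy for f_pi: a car parking beyond a free spot it would have
   accepted is impossible, so the spot was already taken by an earlier car.
   Conversely, parking with the preferences read off a greedy word reproduces
   that word. Hence the weary permutations of pi and of PT(pi) coincide, which
   makes the two maps mutually inverse. Records correspond because a vertex is
   visited before x only if some vertex on the path from x to 0 is at least as
   large. *)
Require Import Defs.
From mathcomp Require Import all_boot.

Set Implicit Arguments.
Unset Strict Implicit.
Unset Printing Implicit Defensive.

Lemma ohead_filter_enum_ord m (P : pred 'I_m) :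
  if ohead [seq v <- enum 'I_m | P v] is Some v
  then P v /\ forall u : 'I_m, P u -> v <= u
  else forall u, ~~ P u.
Proof.
have srt : sorted (relpre val ltn) [seq v <- enum 'I_m | P v].
  apply: sorted_filter; first by move=> x y z; apply: ltn_trans.
  by rewrite -sorted_map val_enum_ord iota_ltn_sorted.
have memE u : (u \in [seq v <- enum 'I_m | P v]) = P u.
  by rewrite mem_filter mem_enum andbT.
case: [seq v <- enum 'I_m | P v] srt memE => [|v s] /= srt memE.
  by move=> u; rewrite -memE.
split=> [|u]; first by rewrite -memE mem_head.
rewrite -memE inE => /predU1P[-> //|us].
have /allP/(_ u us) : all (relpre val ltn v) s.
  by apply: order_path_min srt; move=> x y z; apply: ltn_trans.
exact: ltnW.
Qed.

Lemma label_neq0 n (i : 'I_n) : label i != ord0.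
Proof. by []. Qed.

Lemma label_inj n : injective (@label n).
Proof. exact: lift_inj. Qed.

Lemma ltn_label n (i j : 'I_n) : (label i < label j) = (i < j).
Proof. by rewrite !lift0. Qed.

Variant vertex_spec n : 'I_n.+1 -> Prop :=
  | VertexRoot : vertex_spec ord0
  | VertexLabel (i : 'I_n) : vertex_spec (label i).

Lemma vertexP n (x : 'I_n.+1) : vertex_spec x.
Proof. by case: (unliftP ord0 x) => [i|] ->; constructor. Qed.

Lemma set2_eq (T : finType) (x y a b : T) :
  [set x; y] = [set a; b] -> (x = a /\ y = b) \/ (x = b /\ y = a).
Proof.
move=> eqS.
have xS : x \in [set a; b] by rewrite -eqS set21.
have yS : y \in [set a; b] by rewrite -eqS set22.
have aS : a \in [set x; y] by rewrite eqS set21.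
have bS : b \in [set x; y] by rewrite eqS set22.
case/set2P: xS => xE; case/set2P: yS => yE; subst; auto.
- by move: bS; rewrite !inE orbb => /eqP ->; auto.
- by move: aS; rewrite !inE orbb => /eqP ->; auto.
Qed.

Definition graph_of n (f : 'I_n -> 'I_n.+1) : graph n :=
  [set [set label i; f i] | i : 'I_n].

Definition child_of n (f : 'I_n -> 'I_n.+1) : rel 'I_n.+1 :=
  fun x y => [exists i, (x == label i) && (y == f i)].

Lemma child_ofP n (f : 'I_n -> 'I_n.+1) x y :
  reflect (exists2 i, x = label i & y = f i) (child_of f x y).
Proof.
apply: (iffP existsP) => [[i /andP[/eqP -> /eqP ->]]|[i -> ->]].
  by exists i.
by exists i; rewrite !eqxx.
Qed.

Lemma adjC n (E : graph n) : symmetric (adj E).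
Proof. by move=> x y; rewrite /adj setUC. Qed.

Lemma adj_graph_of n (f : 'I_n -> 'I_n.+1) x y :
  adj (graph_of f) x y = child_of f x y || child_of f y x.
Proof.
apply/imsetP/orP => [[i _ /set2_eq[[-> ->]|[-> ->]]]|].
- by left; apply/child_ofP; exists i.
- by right; apply/child_ofP; exists i.
by case=> /child_ofP[i -> ->]; exists i; rewrite // setUC.
Qed.

Lemma root_pathP n (E : graph n) k : (forall x y, connect (adj E) x y) ->
  [/\ path (adj E) k (root_path E k), last k (root_path E k) = ord0
    & uniq (k :: root_path E k)].
Proof.
move=> conn; rewrite /root_path; case: pickP => [p /and3P[? /eqP ? ?]|] //.
case/connectP: (conn k ord0) => p0 /shortenP[p pth unip _] lastp.
have szp : size p <= n.
  by have := uniq_leq_size unip (fun x _ => mem_enum 'I_n.+1 x); rewrite size_enum_ord.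
by move=> /(_ (Bseq szp))/and3P[]; split=> //; apply/eqP.
Qed.

Section RankedGraph.

Variables (n : nat) (f : 'I_n -> 'I_n.+1) (r : 'I_n.+1 -> nat).
Hypothesis f_lt : forall i, r (f i) < r (label i).

Lemma connect_root x : connect (adj (graph_of f)) x ord0.
Proof.
have [m] := ubnP (r x); elim: m => // m IH in x *.
case: (vertexP x) => [//|i]; rewrite ltnS => le_m.
apply: connect_trans (IH _ (leq_trans (f_lt i) le_m)).
by apply: connect1; rewrite adj_graph_of; apply/orP; left; apply/child_ofP; exists i.
Qed.

Lemma connect_graph_of x y : connect (adj (graph_of f)) x y.
Proof.
apply: connect_trans (connect_root x) _.
by rewrite sym_connect_sym ?connect_root //; apply: adjC.
Qed.

(* A vertex of maximal rank on a cycle has its parent as its only neighbour. *)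
Lemma graph_of_acyclic c : 2 < size c -> ~~ ucycleb (adj (graph_of f)) c.
Proof.
move=> szc; apply/negP => /andP[cyc unic].
have [v vc vmax] : exists2 v, v \in c & forall u, u \in c -> r u <= r v.
  have [x0 x0c] : exists x, x \in c by case: (c) szc => // x; exists x; apply: mem_head.
  by case: (@arg_maxnP _ x0 (mem c) r x0c) => v vc vmax; exists v.
case: (rot_to vc) => k c' rotE.
have up u : u \in c -> adj (graph_of f) v u -> child_of f v u.
  move=> uc; rewrite adj_graph_of => /orP[//|/child_ofP[i uE vE]].
  by have := vmax u uc; rewrite uE vE leqNgt f_lt.
have memE u : u \in v :: c' -> u \in c by rewrite -rotE mem_rot.
move: cyc unic szc; rewrite -(rot_cycle k) -(rot_uniq k) -(size_rot k) rotE.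
case: c' {rotE} memE => [//|a [//|b c']] memE.
rewrite /cycle rcons_path => /andP[/= /andP[va _] lv] /and3P[_ anin _] _.
have lin : last b c' \in b :: c' := mem_last b c'.
have ac : a \in c by apply: memE; rewrite !inE eqxx orbT.
have /child_ofP[i vE aE] := up a ac va.
have /child_ofP[j vE' lE] : child_of f v (last b c').
  by apply: up; [apply: memE; rewrite !inE -in_cons lin !orbT | rewrite adjC].
have ij : i = j by apply: label_inj; rewrite -vE.
by move: anin; rewrite aE ij -lE lin.
Qed.

Lemma is_tree_graph_of : is_tree (graph_of f).
Proof.
apply/and3P; split.
- apply/forall_inP => e /imsetP[i _ ->]; rewrite cards2.
  by have [fE|//] := eqVneq (label i) (f i); have := f_lt i; rewrite -fE ltnn.
- by apply/forallP => x; apply/forallP => y; apply: connect_graph_of.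
- by apply/forallP => c; apply/implyP; apply: graph_of_acyclic.
Qed.

Lemma simple_path_to_root x p :
  path (adj (graph_of f)) x p -> last x p = ord0 -> uniq (x :: p) ->
  path (child_of f) x p.
Proof.
elim: p x => //= a p IH x /andP[xa pth] lastp /andP[xnin unip].
have ap := IH a pth lastp unip; rewrite ap andbT.
move: xa; rewrite adj_graph_of => /orP[//|/child_ofP[i aE xE]].
case: p ap lastp xnin {IH pth unip} => [_ /= a0|b p /= /andP[/child_ofP[j aE' bE] _] _].
  by have := label_neq0 i; rewrite -aE a0.
have ij : i = j by apply: label_inj; rewrite -aE.
by rewrite xE bE ij !inE eqxx orbT.
Qed.

Lemma root_path_graph_of x :
  path (child_of f) x (root_path (graph_of f) x) /\
  last x (root_path (graph_of f) x) = ord0.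
Proof.
have [pth lastp unip] := root_pathP x connect_graph_of.
by split=> //; apply: simple_path_to_root.
Qed.

Lemma parent_graph_of i : parent (graph_of f) i = f i.
Proof.
rewrite /parent; have [] := root_path_graph_of (label i).
by case: (root_path _ _) => [|a p /= /andP[/child_ofP[j /label_inj <- ->]]].
Qed.

End RankedGraph.

Definition word n (w : seq 'I_n.+1) :=
  [/\ uniq w, size w = n.+1 & nth ord0 w 0 = ord0].

Definition ranks n (f : 'I_n -> 'I_n.+1) (w : seq 'I_n.+1) :=
  forall i, index (f i) w < index (label i) w.

(* The last clause compares [label i], at the time it is listed, with any other
   vertex [label j] available at that time. *)
Definition greedy n (f : 'I_n -> 'I_n.+1) (w : seq 'I_n.+1) :=
  [/\ word w, ranks f w
    & forall i j, index (f j) w < index (label i) w < index (label j) w -> i < j].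

Section Word.

Variables (n : nat) (w : seq 'I_n.+1).
Hypothesis w_word : word w.

Lemma mem_word x : x \in w.
Proof.
case: w_word => unw szw _.
have [|_ ->] := uniq_min_size unw (fun y _ => mem_enum 'I_n.+1 y).
  by rewrite szw size_enum_ord.
by rewrite mem_enum.
Qed.

Lemma index_word_lt x : index x w < n.+1.
Proof. by case: w_word => _ szw _; rewrite -[X in _ < X]szw index_mem mem_word. Qed.

Lemma index_word_inj : injective (index^~ w).
Proof. by move=> x y /(congr1 (nth ord0 w)); rewrite !nth_index ?mem_word. Qed.

Lemma index_word_nth j : j < n.+1 -> index (nth ord0 w j) w = j.
Proof. by case: w_word => unw szw _ lt_j; rewrite index_uniq ?szw. Qed.

Lemma index_root : index ord0 w = 0.
Proof. by case: w_word => _ _ <-; rewrite index_word_nth. Qed.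

Lemma index_label (i : 'I_n) : exists j : 'I_n, index (label i) w = j.+1.
Proof.
have := index_word_lt (label i); have: 0 < index (label i) w.
  rewrite lt0n -index_root; apply/negP => /eqP/index_word_inj/eqP.
  by rewrite (negPf (label_neq0 i)).
by case: index => // j _ lt_j; exists (Ordinal (lt_j : j < n)).
Qed.

Lemma word_label j : j < n -> exists2 i : 'I_n, nth ord0 w j.+1 = label i
  & index (label i) w = j.+1.
Proof.
move=> lt_j; have := index_word_nth (lt_j : j.+1 < n.+1).
by case: (vertexP (nth ord0 w j.+1)) => [|i iE]; [rewrite index_root|exists i].
Qed.

End Word.

Lemma greedy_take n (f : 'I_n -> 'I_n.+1) w w' j i i' :
  greedy f w -> greedy f w' -> take j w = take j w' ->
  index (label i) w = j -> index (label i') w' = j -> i' <= i.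
Proof.
move=> [ww rw _] [ww' _ gw'] eqt iw iw'.
have [->//|neq_ii'] := eqVneq i' i; apply/ltnW.
have szw : size w = n.+1 by case: ww.
have szw' : size w' = n.+1 by case: ww'.
have lt_j : j <= n.+1 by rewrite -iw ltnW ?index_word_lt.
have takeE x : (index x w' < j) = (index x w < j).
  by rewrite -!in_take_leq ?szw ?szw' ?eqt.
apply: gw'; rewrite iw' takeE -{1}iw rw ltn_neqAle leqNgt takeE iw ltnn andbT.
apply: contraNneq neq_ii' => jE; apply/eqP/label_inj.
by apply: (index_word_inj ww'); rewrite iw'.
Qed.

Lemma greedy_uniq n (f : 'I_n -> 'I_n.+1) w w' :
  greedy f w -> greedy f w' -> w = w'.
Proof.
move=> gw gw'; have [ww _ _] := gw; have [ww' _ _] := gw'.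
have [_ szw w0] := ww; have [_ szw' w0'] := ww'.
suff takeE j : j <= n.+1 -> take j w = take j w'.
  by have := takeE n.+1 (leqnn _); rewrite !take_oversize ?szw ?szw'.
elim: j => [|j IH] lt_j; first by rewrite !take0.
rewrite !(take_nth ord0) ?szw ?szw' // IH ?(ltnW lt_j) //; congr rcons.
case: j => [|j] in IH lt_j *; first by rewrite w0 w0'.
have [i -> iw] := word_label ww lt_j; have [i' -> iw'] := word_label ww' lt_j.
have eqt := IH (ltnW lt_j).
congr label; apply/val_inj/eqP; rewrite eqn_leq.
by rewrite (greedy_take gw gw' eqt iw iw') (greedy_take gw' gw (esym eqt) iw' iw).
Qed.

Section Search.

Variables (n : nat) (E : graph n).

Definition candidate s v := (v \notin s) && has (fun u => adj E u v) s.

Lemma search_stepP s :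
  (exists2 v, search_step E s = rcons s v
     & candidate s v /\ forall u, candidate s u -> v <= u)
  \/ search_step E s = s /\ forall u, ~~ candidate s u.
Proof.
rewrite /search_step -/(candidate s).
have := ohead_filter_enum_ord (candidate s).
by case: ohead => [v cv|nc]; [left; exists v | right].
Qed.

Lemma search_decomp m v :
  v \in iter m (search_step E) [:: ord0] -> v != ord0 ->
  exists s t, [/\ iter m (search_step E) [:: ord0] = s ++ v :: t,
    candidate s v & forall u, candidate s u -> v <= u].
Proof.
move=> + vN0; elim: m => [|m IH] /=; first by rewrite inE (negPf vN0).
set s := iter m _ _ in IH *.
have [[u -> [cu umin]]|[-> _]] := search_stepP s; last exact: IH.
rewrite mem_rcons inE => /predU1P[->|/IH[s1 [s2 [-> cv vmin]]]].
  by exists s, [::]; rewrite cats1.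
by exists s1, (rcons s2 u); rewrite rcons_cat.
Qed.

Lemma search_uniq m : uniq (iter m (search_step E) [:: ord0]).
Proof.
elim: m => //= m IH; case: (search_stepP (iter m (search_step E) [:: ord0])).
  by case=> v -> [/andP[vs _] _]; rewrite rcons_uniq vs.
by case=> ->.
Qed.

Lemma search_root m :
  exists s, iter m (search_step E) [:: ord0] = ord0 :: s.
Proof.
elim: m => [|m [s /= ->]]; first by exists [::].
have [[v -> _]|[-> _]] := search_stepP (ord0 :: s); last by exists s.
by exists (rcons s v).
Qed.

Hypothesis conn : forall x y, connect (adj E) x y.

Lemma search_size m : m <= n -> size (iter m (search_step E) [:: ord0]) = m.+1.
Proof.
elim: m => //= m IH lt_m; have {IH} szs := IH (ltnW lt_m).
have [s' sE] := search_root m; set s := iter m _ _ in sE szs *.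
have [[v -> _]|[_ nc]] := search_stepP s; first by rewrite size_rcons szs.
have s_all x : x \in s.
  have /connectP[p pth ->] := conn ord0 x.
  have: ord0 \in s by rewrite sE mem_head.
  elim: p ord0 pth => //= b p IH a /andP[ab pth] sa; apply: IH => //.
  apply: contraR (nc b) => bs; rewrite /candidate bs.
  by apply/hasP; exists a.
have := uniq_leq_size (enum_uniq 'I_n.+1) (fun x _ => s_all x).
by rewrite size_enum_ord szs ltnS leqNgt lt_m.
Qed.

Lemma tree_weary_word : word (tree_weary E).
Proof.
split; [exact: search_uniq | exact: search_size|].
by rewrite /tree_weary; have [s ->] := search_root n.
Qed.

Lemma tree_wearyP v : v != ord0 ->
  (exists2 u, adj E u v & index u (tree_weary E) < index v (tree_weary E))
  /\ forall u u', adj E u u' ->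
     index u (tree_weary E) < index v (tree_weary E) <= index u' (tree_weary E) ->
     v <= u'.
Proof.
have ww := tree_weary_word; have [unw szw w0] := ww.
move=> /(search_decomp (mem_word ww v))[s [t [wE]]]; rewrite -/(tree_weary E) in wE.
move=> /andP[vs /hasP[u us uv]] vmin.
have vE : index v (tree_weary E) = size s.
  by rewrite wE index_cat (negPf vs) /= eqxx addn0.
have memE x : (index x (tree_weary E) < index v (tree_weary E)) = (x \in s).
  rewrite vE -in_take_leq ?wE ?take_size_cat //.
  by rewrite size_cat leq_addr.
split; first by exists u; rewrite // memE.
move=> a b ab; rewrite memE leqNgt memE => /andP[sa sb]; apply: vmin.
by rewrite /candidate sb; apply/hasP; exists a.
Qed.

End Search.

Lemma tree_weary_greedy n (f : 'I_n -> 'I_n.+1) (r : 'I_n.+1 -> nat) :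
  (forall i, r (f i) < r (label i)) -> greedy f (tree_weary (graph_of f)).
Proof.
move=> f_lt; have conn := connect_graph_of f_lt.
have ww := tree_weary_word conn.
have fl i : adj (graph_of f) (f i) (label i).
  by rewrite adj_graph_of; apply/orP; right; apply/child_ofP; exists i.
have rw : ranks f (tree_weary (graph_of f)).
  move=> i; have [m] := ubnP (index (label i) (tree_weary (graph_of f))).
  elim: m => // m IH in i *; rewrite ltnS => le_m.
  have [[u uv lt_uv] _] := tree_wearyP conn (label_neq0 i).
  move: uv; rewrite adj_graph_of => /orP[]/child_ofP[j]; last first.
    by move=> /label_inj <- uE; rewrite -uE.
  move=> uE lE; rewrite uE in lt_uv.
  have := IH j (leq_trans lt_uv le_m); rewrite -lE => /(ltn_trans lt_uv).
  by rewrite ltnn.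
split=> // i j /andP[lt_fi lt_ij].
have [_ /(_ _ _ (fl j))] := tree_wearyP conn (label_neq0 i).
rewrite lt_fi (ltnW lt_ij) => /(_ isT); rewrite !lift0 ltnS leq_eqVlt.
by case/predU1P=> // /val_inj ij; rewrite ij ltnn in lt_ij.
Qed.

(* An edge of [E] outside the graph of [g] closes a cycle, as the latter graph
   is connected. *)
Lemma tree_graph_of n (E : graph n) : is_tree E ->
  exists g : 'I_n -> 'I_n.+1, ranks g (tree_weary E) /\ E = graph_of g.
Proof.
case/and3P => /forall_inP card2 /forallP conn0 /forallP acyc.
have conn x y : connect (adj E) x y by have /forallP := conn0 x.
have : forall i : 'I_n, exists u, adj E (label i) u
    /\ index u (tree_weary E) < index (label i) (tree_weary E).
  move=> i; have [[u uv lt_u] _] := tree_wearyP conn (label_neq0 i).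
  by exists u; rewrite adjC.
case/fin_all_exists => g gP; exists g.
have rg : ranks g (tree_weary E) by move=> i; have [] := gP i.
have subE x y : adj (graph_of g) x y -> adj E x y.
  rewrite adj_graph_of => /orP[]/child_ofP[i -> ->]; last rewrite adjC.
    by have [] := gP i.
  by have [] := gP i.
split=> //; apply/eqP; rewrite eqEsubset; apply/andP; split; last first.
  by apply/subsetP => e /imsetP[i _ ->]; have [] := gP i.
apply/subsetP => e eE; have /cards2P[x [y [xy eE']]] := card2 e eE; subst e.
apply: contraT => xynin.
have /connectP[p0] := connect_graph_of (r := index^~ (tree_weary E)) rg y x.
case/shortenP=> p pth unip _ xE.
have szp : size (y :: p) <= n.+1.
  have := uniq_leq_size unip (fun z _ => mem_enum 'I_n.+1 z).
  by rewrite size_enum_ord.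
have /implyP nocyc := acyc (Bseq szp).
have /nocyc/negP[] : 2 < size (y :: p); last first.
  apply/andP; split=> //; rewrite /= rcons_path -xE.
  by rewrite (sub_path subE pth).
case: p pth xE {unip szp nocyc} => [_ xE|a [|//] /=]; first by rewrite xE eqxx in xy.
rewrite andbT => ya xE; rewrite -xE adjC in ya.
by rewrite /adj (negPf xynin) in ya.
Qed.

Lemma tree_parent n (E : graph n) : is_tree E ->
  E = graph_of (parent E) /\ greedy (parent E) (tree_weary E).
Proof.
move=> /tree_graph_of[g [rg EE]].
have pE : parent E =1 g.
  by move=> i; rewrite EE (parent_graph_of (r := index^~ (tree_weary E)) rg).
have rp : ranks (parent E) (tree_weary E) by move=> i; rewrite pE.
have EE' : E = graph_of (parent E).
  by rewrite {1}EE; apply: eq_imset => i; rewrite pE.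
split=> //; rewrite {2}EE'.
exact: (tree_weary_greedy (r := index^~ (tree_weary E))) rp.
Qed.

Section Parking.

Variables (n : nat) (pi : n.-tuple nat).

Definition park_cars (l : seq 'I_n) : street n :=
  foldl (park_car pi) [ffun=> None] l.

Lemma park_cars_rcons l i : park_cars (rcons l i) = park_car pi (park_cars l) i.
Proof. by rewrite /park_cars -cats1 foldl_cat. Qed.

Lemma park_carP (s : street n) i :
  (exists2 j : 'I_n, park_car pi s i = [ffun k => if k == j then Some i else s k]
     & [/\ s j = None, tnth pi i <= j.+1
         & forall k : 'I_n, tnth pi i <= k.+1 -> s k = None -> j <= k])
  \/ park_car pi s i = s /\ forall k : 'I_n, tnth pi i <= k.+1 -> s k <> None.
Proof.
rewrite /park_car.
have := ohead_filter_enum_ord (fun j : 'I_n => (tnth pi i <= j.+1) && (s j == None)).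
case: ohead => [j [/andP[le_j /eqP sj] jmin]|nofree]; [left|right].
  by exists j; split=> // k le_k sk; apply: jmin; rewrite le_k sk.
by split=> // k le_k sk; have := nofree k; rewrite le_k sk.
Qed.

Lemma park_cars_decomp l j i : park_cars l j = Some i ->
  exists l1 l2, [/\ l = l1 ++ i :: l2, tnth pi i <= j.+1
    & forall k : 'I_n, tnth pi i <= k.+1 -> k < j -> park_cars l1 k != None].
Proof.
elim/last_ind: l => [|l a IH]; first by rewrite ffunE.
rewrite park_cars_rcons; have [[k -> [sk le_k kmin]]|[-> _]] := park_carP (park_cars l) a.
  rewrite ffunE; case: eqP => [-> [<-]|_ /IH[l1 [l2 [-> le_i full]]]].
    exists l, [::]; rewrite cats1; split=> // m le_m lt_mk.
    by apply/eqP => /(kmin m le_m); rewrite leqNgt lt_mk.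
  by exists l1, (rcons l2 a); rewrite rcons_cat.
by case/IH=> l1 [l2 [-> le_i full]]; exists l1, (rcons l2 a); rewrite rcons_cat.
Qed.

Lemma park_cars_cat l1 l2 j i :
  park_cars l1 j = Some i -> park_cars (l1 ++ l2) j = Some i.
Proof.
move=> l1j; elim/last_ind: l2 => [|l2 a IH]; first by rewrite cats0.
rewrite -rcons_cat park_cars_rcons.
have [[k -> [sk _ _]]|[-> _]] := park_carP (park_cars (l1 ++ l2)) a => //.
by rewrite ffunE; case: eqP => // jk; rewrite -jk IH in sk.
Qed.

Lemma park_weary_nth (j : 'I_n) :
  nth ord0 (park_weary pi) j.+1 = oapp (@label n) ord0 (parked pi j).
Proof. by rewrite /= (nth_map j) ?size_enum_ord // nth_ord_enum. Qed.

Lemma enum_ord_cat (l1 l2 : seq 'I_n) i k :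
  enum 'I_n = l1 ++ i :: l2 -> (k \in l1) = (k < i).
Proof.
move=> enumE; have := enum_uniq 'I_n; rewrite enumE cat_uniq /= => /and3P[_ nin _].
have il1 : i \notin l1 by case/norP: nin.
have iE : i = size l1 :> nat.
  by rewrite -[LHS]index_enum_ord enumE index_cat (negPf il1) /= eqxx addn0.
have <- : take i (enum 'I_n) = l1 by rewrite enumE take_size_cat.
by rewrite in_take ?mem_enum // index_enum_ord.
Qed.

Hypothesis pi_parking : is_parking pi.

Lemma park_weary_word : word (park_weary pi).
Proof.
case/andP: pi_parking => _ /forallP all_parked.
have /fin_all_exists[s sP] : forall i, exists j, parked pi j = Some i.
  by move=> i; have /existsP[j /eqP] := all_parked i; exists j.
have s_inj : injective s by move=> i j /(congr1 (parked pi)); rewrite !sP => -[].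
have [c _ cK] := injF_bij s_inj.
have wE : park_weary pi = ord0 :: [seq label (c j) | j <- enum 'I_n].
  by congr cons; apply: eq_map => j; rewrite -[in LHS](cK j) sP.
split=> //; last by rewrite /= size_map size_enum_ord.
rewrite wE cons_uniq; apply/andP; split.
  by apply/mapP => -[j _ /eqP]; rewrite eq_sym (negPf (label_neq0 _)).
rewrite map_inj_uniq ?enum_uniq // => j k /label_inj/(congr1 s).
by rewrite !cK.
Qed.

Lemma parked_index j i :
  parked pi j = Some i <-> index (label i) (park_weary pi) = j.+1.
Proof.
have ww := park_weary_word; split=> [pj|iE].
  have := index_word_nth ww (ltn_ord j : j.+1 < n.+1).
  by rewrite park_weary_nth pj.
have := park_weary_nth j; rewrite -iE nth_index ?mem_word //.
case: (parked pi j) => [k /label_inj ->//|/eqP]; by rewrite (negPf (label_neq0 i)).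
Qed.

Lemma index_park_parent i :
  (index (park_parent pi i) (park_weary pi)).+1 = tnth pi i.
Proof.
case/andP: (pi_parking) => /all_tnthP/(_ i)/andP[gt0 le_n] _.
rewrite index_word_nth ?subn1 ?prednK ?leq_pred //; first exact: park_weary_word.
exact: leqW.
Qed.

Lemma park_weary_greedy : greedy (park_parent pi) (park_weary pi).
Proof.
have parkedE i : exists j, parked pi j = Some i.
  by case/andP: pi_parking => _ /forallP/(_ i)/existsP[j /eqP]; exists j.
split; first exact: park_weary_word.
  move=> i; rewrite index_park_parent; have [j pj] := parkedE i.
  have [l1 [l2 [_ le_j _]]] := park_cars_decomp pj.
  by have /parked_index -> := pj.
move=> i k; rewrite index_park_parent.
have [j pj] := parkedE i; have [m pm] := parkedE k.
have /parked_index -> := pj; have /parked_index -> := pm.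
rewrite ltnS => /andP[le_j lt_jm].
have [l1 [l2 [enumE _ /(_ j le_j lt_jm)]]] := park_cars_decomp pm.
case l1j: (park_cars l1 j) => [a|//] _.
have := park_cars_cat (k :: l2) l1j; rewrite -enumE -[LHS]/(parked pi j) pj => -[aE].
have [l3 [l4 [l1E _ _]]] := park_cars_decomp l1j.
by rewrite -(enum_ord_cat _ enumE) l1E aE mem_cat mem_head orbT.
Qed.

End Parking.

Section GreedyParking.

Variables (n : nat) (f : 'I_n -> 'I_n.+1) (w : seq 'I_n.+1) (pi : n.-tuple nat).
Hypothesis f_greedy : greedy f w.
Hypothesis piE : forall i, tnth pi i = (index (f i) w).+1.

Lemma park_cars_greedy l1 l2 j i : enum 'I_n = l1 ++ l2 ->
  park_cars pi l1 j = Some i <-> i \in l1 /\ index (label i) w = j.+1.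
Proof.
have [ww rw gw] := f_greedy.
elim/last_ind: l1 l2 j i => [|l a IH] l2 j i enumE.
  by rewrite ffunE; split=> // -[].
rewrite cat_rcons in enumE; have {}IH k m := IH _ k m enumE.
have memE k : (k \in l) = (k < a) := enum_ord_cat k enumE.
have [j0 j0E] := index_label ww a.
have le_j0 : tnth pi a <= j0.+1 by rewrite piE -j0E rw.
have free_j0 : park_cars pi l j0 = None.
  case pj0: (park_cars pi l j0) => [k|//]; have /IH[kl kE] := pj0.
  have /label_inj ka : label k = label a by apply: (index_word_inj ww); rewrite kE.
  by rewrite memE ka ltnn in kl.
rewrite park_cars_rcons.
have [[k -> [free_k le_k kmin]]|[_ /(_ j0 le_j0)//]] := park_carP pi (park_cars pi l) a.
have {kmin free_k le_k} -> : k = j0.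
  have := kmin j0 le_j0 free_j0; rewrite leq_eqVlt => /predU1P[/val_inj//|lt_k].
  have [b _ bE] := word_label ww (ltn_ord k).
  have bl : b \in l by rewrite memE gw // bE j0E -piE le_k.
  by have := (IH k b).2 (conj bl bE); rewrite free_k.
rewrite ffunE mem_rcons inE; case: eqP => [->|neq_j].
  rewrite -j0E; split=> [[->]|[_ /(index_word_inj ww)/label_inj ->//]].
  by rewrite eqxx.
split=> [/IH[-> ->]|[/predU1P[->|il]]]; first by rewrite orbT.
  by rewrite j0E => -[/val_inj/esym].
by move=> iE; apply/IH.
Qed.

Lemma parked_greedy j i : parked pi j = Some i <-> index (label i) w = j.+1.
Proof.
have parkE := @park_cars_greedy (enum 'I_n) [::] j i (esym (cats0 _)).
by split=> [/parkE[]|iE] //; apply/parkE; rewrite mem_enum.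
Qed.

Lemma greedy_is_parking : is_parking pi.
Proof.
have [ww rw _] := f_greedy; apply/andP; split.
  apply/all_tnthP => i; rewrite piE /=.
  by apply: leq_trans (rw i) _; rewrite -ltnS index_word_lt.
apply/forallP => i; apply/existsP.
have [j jE] := index_label ww i.
by exists j; apply/eqP/parked_greedy.
Qed.

Lemma greedy_park_weary : park_weary pi = w.
Proof.
have [ww _ _] := f_greedy; have [_ szw w0] := ww.
apply: (@eq_from_nth _ ord0); first by rewrite /= size_map size_enum_ord szw.
case=> [_|j]; first by rewrite w0.
rewrite /= size_map size_enum_ord ltnS => lt_j.
have := park_weary_nth pi (Ordinal lt_j); have [i -> iE] := word_label ww lt_j.
by have /parked_greedy -> : index (label i) w = (Ordinal lt_j).+1 := iE.
Qed.

End GreedyParking.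

Section Records.

Variables (n : nat) (f : 'I_n -> 'I_n.+1) (w : seq 'I_n.+1).
Hypothesis f_greedy : greedy f w.

Lemma ancestor_index x p :
  path (child_of f) x p -> {in p, forall v, index v w < index x w}.
Proof.
have [_ rw _] := f_greedy; move=> pth; apply/allP.
apply: (@order_path_min _ (fun x y => index y w < index x w)).
  by move=> y z t lt_yz /ltn_trans; apply.
by apply: sub_path pth => y z /child_ofP[i -> ->]; apply: rw.
Qed.

(* A vertex listed before [x] is listed while some ancestor of [x] is
   available, hence does not exceed that ancestor. *)
Lemma listed_before_le k u x p :
  path (child_of f) x p -> last x p = ord0 -> all (fun v : 'I_n.+1 => v <= k) (x :: p) ->
  index u w < index x w -> u <= k.
Proof.
have [ww _ gw] := f_greedy.
elim: p x => [x _ /= -> _|y p IH x /= /andP[xy pth] lastp /and3P[xk yk pk] ux].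
  by rewrite index_root.
have [lt_uy|] := ltnP (index u w) (index y w).
  by apply: IH lt_uy => //; apply/andP.
rewrite leq_eqVlt => /predU1P[/(index_word_inj ww) <- //|lt_yu].
case/child_ofP: xy => i xE yE; subst x y; case: (vertexP u) lt_yu ux => // j lt_yu ux.
apply: leq_trans xk; apply: ltnW; rewrite ltn_label; apply: gw.
by rewrite lt_yu.
Qed.

End Records.

Lemma park_records_tree n (pi : n.-tuple nat) : is_parking pi ->
  park_records pi = tree_records (parking_tree pi).
Proof.
move=> pip; have gw := park_weary_greedy pip; have [ww rw _] := gw.
have [rpath rlast] :=
  all_and2 (root_path_graph_of (r := index^~ (park_weary pi)) rw).
apply/setP => k; rewrite !inE; apply/imsetP/andP => [[j]|[k0 kmax]].
  rewrite inE => /forallP jmax; rewrite /park_omega.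
  have [i -> iE] := word_label ww (ltn_ord j); move=> ->.
  split=> //; apply/allP => v /(ancestor_index gw (rpath _)).
  case: (vertexP v) => // i'; rewrite iE ltnS => lt_i'.
  have [m i'E] := index_label ww i'; rewrite i'E in lt_i'.
  have /implyP/(_ lt_i') := jmax m.
  by rewrite /park_omega -i'E -iE !nth_index ?(mem_word ww) // => /ltnW.
have [i kE] : exists i, k = label i by case: (vertexP k) k0 => // i; exists i.
have [j jE] := index_label ww i; rewrite -kE in jE.
exists j; last by rewrite /park_omega -jE nth_index ?(mem_word ww).
rewrite inE; apply/forallP => m; apply/implyP => /= lt_m.
have mE := index_word_nth ww (ltn_ord m : m.+1 < n.+1).
rewrite /park_omega -jE nth_index ?(mem_word ww) // ltn_neqAle; apply/andP; split.
  by apply/eqP => /val_inj km; rewrite km jE in mE; case: mE lt_m => ->; rewrite ltnn.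
apply: (listed_before_le gw (rpath k) (rlast k)); last by rewrite mE jE.
by rewrite /= leqnn.
Qed.

Theorem theorem3p13 (n : nat) :
  exists (rho : parking_function n -> cayley_tree n)
         (psi : cayley_tree n -> parking_function n),
    [/\ (forall pi : parking_function n,
           sval (rho pi) = parking_tree (sval pi)
           /\ forall i : 'I_n, parent (sval (rho pi)) i = park_parent (sval pi) i),
        bijective rho,
        (forall pi : parking_function n,
           park_records (sval pi) = tree_records (sval (rho pi))),
        (forall T : cayley_tree n, sval (psi T) = pref_seq (sval T))
      & cancel rho psi /\ cancel psi rho].
Proof.
have parkT (pi : parking_function n) :
    ranks (park_parent (sval pi)) (park_weary (sval pi)).
  by have [] := park_weary_greedy (valP pi).
have treeP (pi : parking_function n) : is_tree (parking_tree (sval pi)).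
  exact: (is_tree_graph_of (r := index^~ (park_weary (sval pi)))) (parkT pi).
have parentE (pi : parking_function n) :
    parent (parking_tree (sval pi)) =1 park_parent (sval pi).
  exact: (parent_graph_of (r := index^~ (park_weary (sval pi)))) (parkT pi).
have prefE (E : graph n) i :
    tnth (pref_seq E) i = (index (parent E i) (tree_weary E)).+1.
  by rewrite tnth_mktuple.
have prefP (T : cayley_tree n) : is_parking (pref_seq (sval T)).
  by have [_ gT] := tree_parent (valP T); apply: greedy_is_parking gT (prefE _).
pose rho pi : cayley_tree n :=
  exist (fun E : graph n => is_tree E) _ (treeP pi).
pose psi T : parking_function n :=
  exist (fun a : n.-tuple nat => is_parking a) _ (prefP T).
have rhoK : cancel rho psi.
  move=> pi; apply/val_inj/eq_from_tnth => i /=.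
  have gw := park_weary_greedy (valP pi).
  have gw' : greedy (park_parent (sval pi)) (tree_weary (parking_tree (sval pi))).
    exact: (tree_weary_greedy (r := index^~ (park_weary (sval pi)))) (parkT pi).
  by rewrite prefE parentE -(greedy_uniq gw gw') (index_park_parent (valP pi)).
have psiK : cancel psi rho.
  move=> T; apply/val_inj => /=; have [TE gT] := tree_parent (valP T).
  rewrite [RHS]TE; apply: eq_imset => i; rewrite /park_parent /park_omega.
  rewrite (greedy_park_weary gT (prefE _)) prefE subn1 nth_index //.
  by case: gT => wT _ _; apply: mem_word.
exists rho, psi; split=> //.
- by move=> pi; split=> // i; apply: parentE.
- by exists psi.
by move=> pi; apply: park_records_tree (valP pi).
Qed.
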